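(* Let $f:\mathbb{R}^n\to\mathbb{R}$ be differentiable and $\mu$-strongly convex ($\mu>0$) with $L$-Lipschitz continuous gradient, and let $g(x)=\sum_{i=1}^n g_i(x_i)$, where each $g_i:\mathbb{R}\to\mathbb{R}\cup\{+\infty\}$ is proper, convex and lower semi-continuous. Let $x^*$ be the (unique) minimizer of $f+g$ over $\mathbb{R}^n$, and assume that $x^*$ is nondegenerate. Let $\mathcal{Z}$ be the active-set, let $\delta$ be the minimum distance to the boundary of the subdifferential over $\mathcal{Z}$, and let $\kappa=L/\mu$. Let $x^0\in\mathbb{R}^n$ and let $(x^k)_{k\ge 0}$ be generated by the proximal gradient method with step-size $1/L$. Then the method identifies the active-set after at most $\kappa\log\left(2L\|x^0-x^*\|/\delta\right)$ iterations; that is, for every integer $\bar k\ge 0$ with $$\bar k\ \ge\ \kappa\log\left(\frac{2L\|x^0-x^*\|}{\delta}\right),$$ we have $x_i^k=x_i^*$ for all $k>\bar k$ and all $i\in\mathcal{Z}$.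
   Context: $\|\cdot\|$ is the Euclidean norm, and $\log$ is the natural logarithm (with $\log 0=-\infty$). $\mu$-strong convexity: $f(y)\ge f(x)+\langle\nabla f(x),y-x\rangle+\frac{\mu}{2}\|y-x\|^2$ for all $x,y\in\mathbb{R}^n$. $L$-Lipschitz gradient: $\|\nabla f(y)-\nabla f(x)\|\le L\|y-x\|$ for all $x,y\in\mathbb{R}^n$. Proximal gradient method with step-size $\alpha>0$: $x^{k+1}=\mathrm{prox}_{\alpha g}\left(x^k-\alpha\nabla f(x^k)\right)$, where $\mathrm{prox}_{\alpha g}(x)=\operatorname{argmin}_{y}\left\{\frac12\|y-x\|^2+\alpha g(y)\right\}$. Subdifferential: for $x_i\in\operatorname{dom} g_i$, $\partial g_i(x_i)=\{v\in\mathbb{R}: g_i(y)\ge g_i(x_i)+v(y-x_i)\text{ for all }y\in\operatorname{dom} g_i\}$, which is an interval. When $\partial g_i(x_i^* )$ is not a singleton, write its interior as $(l_i,u_i)$ with $l_i\in\mathbb{R}\cup\{-\infty\}$ and $u_i\in\mathbb{R}\cup\{+\infty\}$. Nondegeneracy of $x^*$: for every $i$, $-\nabla_i f(x^* )=g_i'(x_i^* )$ if $\partial g_i(x_i^* )$ is a singleton ($g_i$ is then differentiable at $x_i^*$), and $-\nabla_i f(x^* )\in\operatorname{int}\partial g_i(x_i^* )$ if $\partial g_i(x_i^* )$ is not a singleton. Active-set: $\mathcal{Z}=\{i:\partial g_i(x_i^* )\text{ is not a singleton}\}$. $\delta=\min_{i\in\mathcal{Z}}\min\{-\nabla_i f(x^*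 )-l_i,\ u_i+\nabla_i f(x^* )\}$ (with value $+\infty$ allowed, in which case $1/\delta=0$). *)

(* Defs.v *)
From mathcomp Require Export all_boot all_order all_algebra.
From mathcomp Require Export all_classical all_reals all_analysis.

Set Implicit Arguments.
Unset Strict Implicit.
Unset Printing Implicit Defensive.
Import Order.TTheory GRing.Theory Num.Theory.
Export numFieldNormedType.Exports.

Local Open Scope classical_set_scope.
Local Open Scope ring_scope.

(* The library norm `|x| on 'rV[R]_n is the sup norm, hence [enorm] for the
   Euclidean one. *)
Definition dotv (R : realType) (n : nat) (u v : 'rV[R]_n) : R :=
  \sum_i u 0 i * v 0 i.

Definition enorm (R : realType) (n : nat) (u : 'rV[R]_n) : R :=
  Num.sqrt (dotv u u).

Definition gradient (R : realType) (n : nat) (f : 'rV[R]_n -> R)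
    (x : 'rV[R]_n) : 'rV[R]_n :=
  \row_i 'D_(delta_mx 0 i) f x.

Definition strongly_convex (R : realType) (n : nat) (mu : R)
    (f : 'rV[R]_n -> R) : Prop :=
  forall x y, f x + dotv (gradient f x) (y - x)
              + mu / 2 * enorm (y - x) ^+ 2 <= f y.

Definition lipschitz_gradient (R : realType) (n : nat) (L : R)
    (f : 'rV[R]_n -> R) : Prop :=
  forall x y, enorm (gradient f y - gradient f x) <= L * enorm (y - x).

(* Extended-valued functions *)

Definition proper_fun (R : realType) (T : Type) (h : T -> \bar R) : Prop :=
  (forall x, h x != -oo%E) /\ (exists x, (h x < +oo)%E).

Definition econvex (R : realType) (h : R -> \bar R) : Prop :=
  forall x y t : R, 0 <= t <= 1 ->
    (h (t * x + (1 - t) * y)%R <= t%:E * h x + (1 - t)%:E * h y)%E.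

Definition argmin (R : realType) (T : Type) (F : T -> \bar R) : set T :=
  [set x | forall y, (F x <= F y)%E].

Definition dom (R : realType) (T : Type) (h : T -> \bar R) : set T :=
  [set x | (h x < +oo)%E].

Definition separable_sum (R : realType) (n : nat) (g : 'I_n -> R -> \bar R)
    (x : 'rV[R]_n) : \bar R :=
  (\sum_i g i (x 0%R i))%E.

(* Set-valued: the proximal point is the element of this set. *)
Definition prox (R : realType) (n : nat) (alpha : R)
    (g : 'rV[R]_n -> \bar R) (x : 'rV[R]_n) : set 'rV[R]_n :=
  argmin (fun y => ((2^-1 * enorm (y - x) ^+ 2)%R%:E + alpha%:E * g y)%E).

Definition proximal_gradient (R : realType) (n : nat) (alpha : R)
    (f : 'rV[R]_n -> R) (g : 'rV[R]_n -> \bar R) (x : nat -> 'rV[R]_n) : Prop :=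
  forall k, prox alpha g (x k - alpha *: gradient f (x k)) (x k.+1).

(* Empty outside [dom h]. *)
Definition subdifferential (R : realType) (h : R -> \bar R) (x : R) : set R :=
  [set v | dom h x /\
           forall y, dom h y -> (h x + (v * (y - x))%R%:E <= h y)%E].

Definition is_singleton (T : Type) (A : set T) : Prop := exists v, A = [set v].

(* When [subdifferential (g i) (x 0 i)] is a singleton, [x 0 i] is interior to
   [dom (g i)], so that [fine \o g i] is the real-valued function [g i] in a
   neighborhood of [x 0 i]. *)
Definition nondegenerate (R : realType) (n : nat) (f : 'rV[R]_n -> R)
    (g : 'I_n -> R -> \bar R) (x : 'rV[R]_n) : Prop :=
  forall i,
    (is_singleton (subdifferential (g i) (x 0 i)) ->
       - gradient f x 0 i = (fine \o g i)^`()%classic (x 0 i)) /\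
    (~ is_singleton (subdifferential (g i) (x 0 i)) ->
       (subdifferential (g i) (x 0 i))° (- gradient f x 0 i)).

Definition active_set (R : realType) (n : nat) (g : 'I_n -> R -> \bar R)
    (x : 'rV[R]_n) : {set 'I_n} :=
  [set i | `[< ~ is_singleton (subdifferential (g i) (x 0 i)) >]]%SET.

Definition subdiff_lower (R : realType) (h : R -> \bar R) (x : R) : \bar R :=
  ereal_inf (EFin @` (subdifferential h x)°).

Definition subdiff_upper (R : realType) (h : R -> \bar R) (x : R) : \bar R :=
  ereal_sup (EFin @` (subdifferential h x)°).

Definition boundary_dist (R : realType) (n : nat) (f : 'rV[R]_n -> R)
    (g : 'I_n -> R -> \bar R) (x : 'rV[R]_n) : \bar R :=
  \big[mine/+oo%E]_(i in active_set g x)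
     mine ((- gradient f x 0 i)%R%:E - subdiff_lower (g i) (x 0%R i))%E
          (subdiff_upper (g i) (x 0%R i) + (gradient f x 0 i)%R%:E)%E.

(* Main.v *)
(* The gradient step [x |-> x - L^-1 * grad f x] is a [(1 - mu / L)]-contraction
   for the Euclidean norm, because the gradient of the convex function
   [f - mu / 2 |.|^2] is cocoercive.  The proximal step is nonexpansive and
   [xstar] is a fixed point, so
   [|x k - xstar| <= exp (- k mu / L) |x 0 - xstar|].  By optimality of the
   proximal step, [w = L (x k - x k.+1)_i - (grad f (x k))_i] is a subgradient of
   [g i] at [x k.+1 0 i].  If [x k.+1 0 i > xstar 0 i], then monotonicity of the
   subdifferential puts [w] above the whole subdifferential at [xstar 0 i], while
   the Lipschitz bounds give [w < - (grad f xstar)_i + 2 L |x k - xstar|]; this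
   is impossible once [2 L |x k - xstar| <= delta].  The case
   [x k.+1 0 i < xstar 0 i] is symmetric. *)
Require Import Defs.
From mathcomp Require Import ring lra.
Set Implicit Arguments.
Unset Strict Implicit.
Unset Printing Implicit Defensive.
Import Order.TTheory GRing.Theory Num.Theory.
Local Open Scope classical_set_scope.
Local Open Scope ring_scope.

(** * Euclidean inner product and norm on row vectors *)

Section Euclidean.
Context {R : realType} {n : nat}.
Implicit Types u v w : 'rV[R]_n.

Lemma dotvC u v : dotv u v = dotv v u.
Proof. by apply: eq_bigr => i _; rewrite mulrC. Qed.

Lemma dotvDl u v w : dotv (u + v) w = dotv u w + dotv v w.
Proof. by rewrite -big_split; apply: eq_bigr => i _; rewrite mxE mulrDl. Qed.

Lemma dotvZl a u v : dotv (a *: u) v = a * dotv u v.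
Proof. by rewrite big_distrr; apply: eq_bigr => i _; rewrite mxE -mulrA. Qed.

Lemma dotvNl u v : dotv (- u) v = - dotv u v.
Proof. by rewrite -scaleN1r dotvZl mulN1r. Qed.

Lemma dotvDr u v w : dotv u (v + w) = dotv u v + dotv u w.
Proof. by rewrite dotvC dotvDl !(dotvC _ u). Qed.

Lemma dotvZr a u v : dotv u (a *: v) = a * dotv u v.
Proof. by rewrite dotvC dotvZl dotvC. Qed.

Lemma dotvNr u v : dotv u (- v) = - dotv u v.
Proof. by rewrite dotvC dotvNl dotvC. Qed.

Definition dotvE := (dotvDl, dotvDr, dotvNl, dotvNr, dotvZl, dotvZr).

Lemma dotvv_ge0 u : 0 <= dotv u u.
Proof. by apply: sumr_ge0 => i _; rewrite -expr2 sqr_ge0. Qed.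

Lemma dotv_delta u i : dotv u (delta_mx 0 i) = u 0 i.
Proof.
rewrite /dotv (bigD1 i) //= mxE !eqxx mulr1 big1 ?addr0 // => j ji.
by rewrite mxE (negPf ji) andbF mulr0.
Qed.

Lemma enorm_ge0 u : 0 <= enorm u.
Proof. exact: sqrtr_ge0. Qed.

Lemma enorm_sqr u : enorm u ^+ 2 = dotv u u.
Proof. by rewrite sqr_sqrtr ?dotvv_ge0. Qed.

Lemma dotvv_eq0 u : dotv u u = 0 -> u = 0.
Proof.
move=> /eqP; rewrite psumr_eq0 => [/allP u0|i _]; last first.
  by rewrite -expr2 sqr_ge0.
apply/rowP => i; rewrite mxE; apply/eqP.
by rewrite -sqrf_eq0 expr2; apply: u0; rewrite mem_index_enum.
Qed.

(** Cauchy-Schwarz: expand the nonnegative square of [dotv v v *: u - dotv u v *: v] and divide by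
    [dotv v v]. *)
Lemma ler_dotv u v : dotv u v <= enorm u * enorm v.
Proof.
have [uv0|uv0] := leP (dotv u v) 0.
  by rewrite (le_trans uv0)// mulr_ge0 ?enorm_ge0.
rewrite -(ler_pXn2r (n := 2)) ?nnegrE ?mulr_ge0 ?enorm_ge0 ?(ltW uv0)//.
rewrite exprMn !enorm_sqr.
have [v0|v0] := eqVneq (dotv v v) 0.
  move: uv0; rewrite (dotvv_eq0 v0) /dotv big1 ?ltxx// => i _.
  by rewrite mxE mulr0.
have {v0} v_gt0 : 0 < dotv v v by rewrite lt_neqAle eq_sym v0 dotvv_ge0.
have := dotvv_ge0 (dotv v v *: u - dotv u v *: v).
rewrite !dotvE (dotvC v u) => h.
rewrite -subr_ge0 -(pmulr_rge0 _ v_gt0); lra.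
Qed.

Lemma ler_coord_enorm u i : `|u 0 i| <= enorm u.
Proof.
rewrite -sqrtr_sqr ler_sqrt ?dotvv_ge0// /dotv (bigD1 i)//= -expr2 lerDl.
by apply: sumr_ge0 => j _; rewrite -expr2 sqr_ge0.
Qed.

Lemma enormZ a u : enorm (a *: u) = `|a| * enorm u.
Proof.
by rewrite /enorm !dotvE mulrA -expr2 sqrtrM ?sqr_ge0// sqrtr_sqr.
Qed.

Lemma enormN u : enorm (- u) = enorm u.
Proof. by rewrite -scaleN1r enormZ normrN1 mul1r. Qed.

Lemma enorm_delta i : enorm (delta_mx 0 i : 'rV[R]_n) = 1.
Proof. by rewrite /enorm dotv_delta mxE !eqxx sqrtr1. Qed.

End Euclidean.

(** * Descent lemma, cocoercivity and contraction of the gradient step *)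

Section SmoothStronglyConvex.
Context {R : realType} {n : nat} {f : 'rV[R]_n -> R} {mu L : R}.
Hypotheses (mu_gt0 : 0 < mu) (f_sc : strongly_convex mu f).
Hypothesis f_lip : lipschitz_gradient L f.
Local Notation G := (gradient f).

(** Add the strong convexity inequalities between 0 and the [i]-th unit vector in both directions,
    then apply Cauchy-Schwarz. The index [i] rules out dimension 0, where the norms carry no
    information. *)
Lemma convexity_le_lipschitz (i : 'I_n) : mu <= L.
Proof.
have h1 := f_sc 0 (delta_mx 0 i); have h2 := f_sc (delta_mx 0 i) 0.
have h3 := f_lip 0 (delta_mx 0 i).
have h4 := ler_dotv (G (delta_mx 0 i) - G 0) (delta_mx 0 i).
move: h1 h2 h3 h4.
rewrite !subr0 sub0r enormN enorm_delta !dotvE; lra.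
Qed.

(* Summing the gradient inequality from [x + (k+1)/N d] to [x + k/N d] over
   [k < N] overestimates [\int_0^1 <G (x + t d), d>] by a right Riemann sum, so
   no integration is needed. *)
Lemma descent_step x d (N k : nat) : (0 < N)%N ->
  f (x + (k%:R / N%:R) *: d) <=
  f x + k%:R / N%:R * dotv (G x) d
      + L * dotv d d * (k%:R * k.+1%:R / (2 * N%:R ^+ 2)).
Proof.
move=> N_gt0; have N0 : N%:R != 0 :> R by rewrite pnatr_eq0 -lt0n.
elim: k => [|k IH]; first by rewrite !mul0r scale0r !addr0 mulr0 addr0.
set p := x + (k.+1%:R / N%:R) *: d; set p' := x + (k%:R / N%:R) *: d in IH.
have pp' : p' - p = - N%:R^-1 *: d.
  rewrite /p /p' opprD addrACA subrr add0r -scalerBl; congr (_ *: _).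
  by rewrite -[k.+1]addn1 natrD; field.
have /= h1 := f_sc p p'.
have h2 : 0 <= mu / 2 * enorm (p' - p) ^+ 2.
  by rewrite mulr_ge0 ?sqr_ge0// divr_ge0 // ltW.
have h3 : dotv (G p - G x) d <= L * (k.+1%:R / N%:R) * dotv d d.
  rewrite (le_trans (ler_dotv _ _))// -enorm_sqr expr2 mulrA.
  rewrite ler_wpM2r ?enorm_ge0// (le_trans (f_lip _ _))//.
  by rewrite /p addrAC subrr add0r enormZ ger0_norm ?divr_ge0// mulrA.
have {}h3 : N%:R^-1 * dotv (G p) d <= N%:R^-1 * dotv (G x) d +
   N%:R^-1 * (L * (k.+1%:R / N%:R) * dotv d d).
  rewrite -mulrDr ler_wpM2l ?invr_ge0// -lerBlDl.
  by move: h3; rewrite dotvDl dotvNl.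
have e1 : k.+1%:R / N%:R * dotv (G x) d =
   k%:R / N%:R * dotv (G x) d + N%:R^-1 * dotv (G x) d.
  by rewrite -[k.+1]addn1 natrD; field.
have e2 : L * dotv d d * (k.+1%:R * k.+2%:R / (2 * N%:R ^+ 2)) =
   L * dotv d d * (k%:R * k.+1%:R / (2 * N%:R ^+ 2)) +
   N%:R^-1 * (L * (k.+1%:R / N%:R) * dotv d d).
  by rewrite -[k.+2]addn2 -[k.+1]addn1 !natrD; field.
rewrite e1 e2; move: h1; rewrite pp' dotvZr mulNr -pp'; lra.
Qed.

Lemma descent x y :
  f y <= f x + dotv (G x) (y - x) + L / 2 * dotv (y - x) (y - x).
Proof.
apply/ler_addgt0Pr => e e_gt0; set d := y - x; set c := L / 2 * dotv d d.
(* Taking [k = N] in [descent_step], the Riemann sum exceeds the integral bound [c] by [c / N]; this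
   [N] makes the excess at most [e]. *)
pose N := (Num.bound `|c / e|).+1.
have N_gt0 : 0 < N%:R :> R by rewrite ltr0n.
have cN : c / N%:R <= e.
  rewrite ler_pdivrMr// mulrC -ler_pdivrMr//.
  rewrite (le_trans (ler_norm _))// (le_trans (ltW (archi_boundP _)))//.
  by rewrite ler_nat.
have := @descent_step x d N N isT.
rewrite divff ?gt_eqF// scale1r mul1r /d addrCA subrr addr0 -/d.
suff -> : L * dotv d d * (N%:R * N.+1%:R / (2 * N%:R ^+ 2)) = c + c / N%:R.
  lra.
by rewrite -[N.+1]addn1 natrD /c; field; rewrite gt_eqF.
Qed.

(** With phi = f - mu / 2 |.|^2, [E] is the difference of the gradients of phi, and the first four
    terms are phi x - phi y + <grad phi x, y - x>. The bound compares two estimates of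
    [f (y - t *: E)]: from below by strong convexity at [x], from above by descent at [y]. *)
Lemma shifted_gradient_gap x y t (E := (G y - G x) - mu *: (y - x)) :
  f x - f y + dotv (G x) (y - x) + mu / 2 * dotv (y - x) (y - x)
  + (t - (L - mu) / 2 * t ^+ 2) * dotv E E <= 0.
Proof.
have := f_sc x (y - t *: E); have := descent y (y - t *: E).
have -> : y - t *: E - x = (y - x) - t *: E by rewrite addrAC.
have -> : y - t *: E - y = - t *: E by rewrite addrAC subrr add0r scaleNr.
rewrite enorm_sqr; set d := y - x.
have EE : dotv E E = dotv (G y) E - dotv (G x) E - mu * dotv d E.
  by rewrite {1}/E -/d !(dotvDl, dotvNl, dotvZl).
clearbody E.
rewrite !(dotvDr _ d) !(dotvDl d) !dotvNl !dotvNr !dotvZl !dotvZr.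
rewrite (dotvC E d); move: EE; set a := dotv E E; set b := dotv (G y) E.
set c := dotv (G x) E; set r := dotv d E.
move=> EE; have -> : b = a + c + mu * r by lra.
lra.
Qed.

(* Cocoercivity of the gradient of [f - mu / 2 |.|^2], which is convex with
   an [(L - mu)]-Lipschitz gradient; [t = (L - mu)^-1] is optimal but
   unavailable when [L = mu]. *)
Lemma cocoercive x y t (E := (G y - G x) - mu *: (y - x)) :
  (2 * t - (L - mu) * t ^+ 2) * dotv E E <= dotv E (y - x).
Proof.
(* Adding the gap inequalities for (x, y) and (y, x) cancels the function values. *)
have := shifted_gradient_gap x y t; have := shifted_gradient_gap y x t.
have -> : x - y = - (y - x) by rewrite opprB.
have -> : G x - G y - mu *: - (y - x) = - E.
  by rewrite /E scalerN opprB -[G x - G y]opprB -opprD opprB addrC opprB addrC.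
rewrite -/E /= !(dotvNl, dotvNr) !opprK.
have : dotv E (y - x) = dotv (G y) (y - x) - dotv (G x) (y - x)
   - mu * dotv (y - x) (y - x) by rewrite /E !(dotvDl, dotvNl, dotvZl).
lra.
Qed.

Lemma gradient_step_contraction x y : mu <= L ->
  enorm ((y - L^-1 *: G y) - (x - L^-1 *: G x))
  <= (1 - mu / L) * enorm (y - x).
Proof.
move=> mu_le_L; have L_gt0 := lt_le_trans mu_gt0 mu_le_L.
have rho_ge0 : 0 <= 1 - mu / L by rewrite subr_ge0 ler_pdivrMr ?mul1r.
rewrite -(ler_pXn2r (n := 2)) ?nnegrE ?mulr_ge0 ?enorm_ge0//.
rewrite exprMn !enorm_sqr.
set d := y - x; set E := (G y - G x) - mu *: d.
have -> : y - L^-1 *: G y - (x - L^-1 *: G x) = (1 - mu / L) *: d - L^-1 *: E.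
  apply/rowP => i; rewrite /E /d !mxE; field; lra.
(* After expansion the squared claim reduces to this bound; for [mu < L] cocoercivity gives it with
   room to spare, without the factor 2. *)
have EE : dotv E E <= 2 * (L - mu) * dotv E d.
  have [l_gt0|] := ltP 0 (L - mu).
    have := cocoercive x y (L - mu)^-1; rewrite /= -/d -/E.
    have -> : 2 / (L - mu) - (L - mu) * (L - mu)^-1 ^+ 2 = (L - mu)^-1.
      by field; rewrite gt_eqF.
    rewrite [_^-1 * _]mulrC ler_pdivrMr// => h; have := dotvv_ge0 E; lra.
  rewrite subr_le0 => L_le_mu; have -> : L - mu = 0 by lra.
  rewrite mulr0 mul0r leNgt; apply/negP => E_gt0.
  (* When [L = mu], cocoercivity reads 2 t |E|^2 <= <E, d> for every t. Here t = 0 gives 0 <= <E,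
     d>, and the present t would give 2 (<E, d> + 1) <= <E, d>; hence E = 0. *)
  have := cocoercive x y ((dotv E d + 1) / dotv E E).
  rewrite /= -/d -/E; have -> : L - mu = 0 by lra.
  have := cocoercive x y 0; rewrite /= -/d -/E mulr0 expr0n mulr0
    subr0 mul0r => h0.
  rewrite mul0r subr0 -mulrA divfK ?gt_eqF//; lra.
clearbody E d; rewrite !dotvE (dotvC d E) -subr_ge0.
have -> : (1 - mu / L) ^+ 2 * dotv d d
   - ((1 - mu / L) * ((1 - mu / L) * dotv d d)
   - (1 - mu / L) * (L^-1 * dotv E d)
   + ((- (L^-1 * ((1 - mu / L) * dotv E d))) - - (L^-1 * (L^-1 * dotv E E)))) =
  (2 * (L - mu) * dotv E d - dotv E E) / L ^+ 2.
  field; lra.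
by rewrite divr_ge0 ?sqr_ge0 ?subr_ge0.
Qed.

End SmoothStronglyConvex.

(** * Subgradients and first-order optimality *)

(** Turns firm nonexpansiveness of the proximal step into nonexpansiveness: [u] will be the
    difference of the inputs, [v] that of the outputs. *)
Lemma enorm_le_dotv {R : realType} {n : nat} (u v : 'rV[R]_n) :
  0 <= dotv (u - v) v -> enorm v <= enorm u.
Proof.
rewrite dotvDl dotvNl subr_ge0 -enorm_sqr expr2 => /le_trans/(_ (ler_dotv u v)).
have [-> _|] := eqVneq (enorm v) 0; first exact: enorm_ge0.
by move=> v0; rewrite ler_pM2r// lt_neqAle eq_sym v0 enorm_ge0.
Qed.

Lemma proper_dom_fin_num {R : realType} (h : R -> \bar R) (t : R) :
  proper_fun h -> dom h t -> h t \is a fin_num.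
Proof. by case=> h_nNy _ ht; rewrite fin_numE h_nNy lt_eqF. Qed.

(** Add the two subgradient inequalities; properness makes [h a] and [h b] finite, so they
    cancel. *)
Lemma subdifferential_monotone {R : realType} (h : R -> \bar R) (a b v w : R) :
  proper_fun h -> subdifferential h a v -> subdifferential h b w ->
  0 <= (v - w) * (a - b).
Proof.
move=> h_proper [ha hv] [hb hw]; move: (hv _ hb) (hw _ ha).
rewrite -(fineK (proper_dom_fin_num h_proper ha)).
rewrite -(fineK (proper_dom_fin_num h_proper hb)) -!EFinD !lee_fin; lra.
Qed.

(* Moving from [x] towards [t] along the [i]-th axis by a fraction [s], the
   quadratic term is [O(s ^ 2)] while all others are linear in [s]. *)
Lemma argmin_subdifferential {R : realType} {n : nat} (F : 'rV[R]_n -> R)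
    (c C : R) (g : 'I_n -> R -> \bar R) (x v : 'rV[R]_n) (i : 'I_n) :
  0 < c -> 0 <= C ->
  (forall j, proper_fun (g j)) -> econvex (g i) ->
  (forall y, F y <= F x + dotv v (y - x) + C * dotv (y - x) (y - x)) ->
  argmin (fun y => ((F y)%:E + c%:E * separable_sum g y)%E) x ->
  subdifferential (g i) (x 0 i) (- v 0 i / c).
Proof.
move=> c_gt0 C_ge0 g_proper gi_convex F_le x_min.
have /choice[z z_dom] : forall j, exists t, (g j t < +oo)%E.
  by move=> j; case: (g_proper j).
have g_nNy j t : g j t != -oo%E by case: (g_proper j).
have x_dom j : dom (g j) (x 0 j).
  (* Otherwise the objective would be infinite at the minimizer [x] but finite at the point with
     coordinates [z j]. *)
  rewrite /dom /= ltey; apply/eqP => gjx.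
  have Sx : separable_sum g x = +oo%E.
    by apply/esum_eqyP => //; exists j; rewrite mem_index_enum.
  have : separable_sum g (\row_j z j) \is a fin_num.
    apply/sum_fin_numP => k _ _; rewrite mxE.
    exact: proper_dom_fin_num (g_proper k) (z_dom k).
  move=> /fineK Sz; have := x_min (\row_j z j).
  by rewrite Sx -Sz gt0_muley ?lte_fin.
split => // t t_dom.
have gx_fin := proper_dom_fin_num (g_proper i) (x_dom i).
have gt_fin := proper_dom_fin_num (g_proper i) t_dom.
set w := - v 0 i / c; rewrite -(fineK gx_fin) -(fineK gt_fin) -EFinD lee_fin.
set a := fine (g i (x 0 i)); set b := fine (g i t); set h := t - x 0 i.
suff : c * (a - b) <= v 0 i * h.
  rewrite mulrC -ler_pdivlMr// => ab.
  have -> : w * h = - (v 0 i * h / c) by rewrite /w mulrAC !mulNr.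
  lra.
apply/ler_addgt0Pr => e e_gt0.
have Ch_ge0 : 0 <= C * h ^+ 2 by rewrite mulr_ge0 ?sqr_ge0.
(* Any [s] in (0, 1] with s C h^2 <= e would do; this choice also covers C h^2 = 0. *)
set s := e / (e + C * h ^+ 2).
have s_gt0 : 0 < s by rewrite divr_gt0//; lra.
have s_le1 : s <= 1 by rewrite ler_pdivrMr; lra.
have sCh : s * (C * h ^+ 2) <= e.
  by rewrite mulrAC ler_pdivrMr; [nra|lra].
set p := x + (s * h) *: delta_mx 0 i.
have p_i : p 0 i = s * t + (1 - s) * x 0 i.
  by rewrite !mxE !eqxx mulr1 /h; ring.
have p_j j : j != i -> p 0 j = x 0 j.
  by move=> ji; rewrite !mxE (negPf ji) mulr0 addr0.
have gp_le : (g i (p 0%R i) <= (s * b + (1 - s) * a)%R%:E)%E.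
  rewrite p_i EFinD !EFinM (fineK gx_fin) (fineK gt_fin).
  by apply: gi_convex; rewrite (ltW s_gt0).
have gp_fin : g i (p 0 i) \is a fin_num.
  by rewrite fin_numE g_nNy lt_eqF// (le_lt_trans gp_le)// ltry.
have := x_min p; rewrite /separable_sum (bigD1 i)//= [in leRHS](bigD1 i)//=.
rewrite [in leRHS](eq_bigr (fun j => g j (x 0 j))); last first.
  by move=> j ji; rewrite p_j.
have T_fin : (\sum_(j < n | j != i) g j (x 0%R j))%E \is a fin_num.
  apply/sum_fin_numP => j _ _.
  exact: proper_dom_fin_num (g_proper j) (x_dom j).
move: gp_le; rewrite -(fineK T_fin) -(fineK gp_fin) -(fineK gx_fin) -/a.
rewrite -!EFinD !lee_fin.
set m := fine (g i (p 0 i)); set T := fine _ => m_le x_le.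
have := F_le p.
have -> : p - x = (s * h) *: delta_mx 0 i by rewrite /p addrAC subrr add0r.
rewrite !dotvE !dotv_delta mxE !eqxx mulr1 => Fp_le.
have cm_le : c * m <= c * (s * b + (1 - s) * a) by rewrite ler_pM2l.
rewrite -(ler_pM2l s_gt0).
have : s * (s * (C * h ^+ 2)) <= s * e by rewrite ler_pM2l.
lra.
Qed.

(** * Linear convergence of the iterates and identification of the active coordinates *)

Section Identification.
Context {R : realType} {n : nat} {mu L : R}.
Context {f : 'rV[R]_n -> R} {g : 'I_n -> R -> \bar R}.
Context {xstar : 'rV[R]_n} {x : nat -> 'rV[R]_n}.
Hypotheses (mu_gt0 : 0 < mu) (mu_le_L : mu <= L).
Hypotheses (f_sc : strongly_convex mu f) (f_lip : lipschitz_gradient L f).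
Hypotheses (g_proper : forall i, proper_fun (g i)).
Hypotheses (g_convex : forall i, econvex (g i)).
Hypothesis xstar_min :
  argmin (fun y => ((f y)%:E + separable_sum g y)%E) xstar.
Hypothesis x_pg : proximal_gradient (1 / L) f (separable_sum g) x.
Local Notation G := (gradient f).
Let L_gt0 : 0 < L := lt_le_trans mu_gt0 mu_le_L.

(** Fermat's rule for [f + g], with the descent lemma as quadratic upper model of [f]. *)
Lemma minimizer_subdifferential i :
  subdifferential (g i) (xstar 0 i) (- G xstar 0 i).
Proof.
rewrite -[X in subdifferential _ _ X]divr1.
apply: (@argmin_subdifferential _ _ f _ (L / 2)) => //.
- by rewrite divr_ge0// ltW.
- exact: (descent mu_gt0 f_sc f_lip).
- by move=> y; rewrite !mul1e; apply: xstar_min.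
Qed.

(** Fermat's rule for the proximal objective, whose quadratic part is its own upper model with
    [C = 2^-1]; dividing by the step-size produces the factor [L]. *)
Lemma iterate_subdifferential k i :
  subdifferential (g i) (x k.+1 0 i)
    (L * (x k 0 i - x k.+1 0 i) - G (x k) 0 i).
Proof.
set z := x k - (1 / L) *: G (x k).
have -> : L * (x k 0 i - x k.+1 0 i) - G (x k) 0 i =
    - (x k.+1 - z) 0 i / (1 / L).
  by rewrite /z !mxE; field; rewrite gt_eqF.
apply: (@argmin_subdifferential _ _
  (fun y => 2^-1 * enorm (y - z) ^+ 2) _ 2^-1).
- by rewrite divr_gt0.
- by rewrite invr_ge0.
- by [].
- by [].
- move=> y; rewrite !enorm_sqr; set u := x k.+1 - z.
  have -> : y - z = (y - x k.+1) + u by rewrite /u addrA subrK.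
  by clearbody u; rewrite !dotvE [dotv (x _) u]dotvC [dotv y u]dotvC; lra.
- exact: x_pg.
Qed.

Lemma iterate_contraction k :
  enorm (x k.+1 - xstar) <= (1 - mu / L) * enorm (x k - xstar).
Proof.
apply: le_trans
  (gradient_step_contraction mu_gt0 f_sc f_lip xstar (x k) mu_le_L).
(* Firm nonexpansiveness holds coordinatewise: each summand is [L^-1] times a product that is
   nonnegative by monotonicity of the subdifferential. *)
apply: enorm_le_dotv; apply: sumr_ge0 => i _.
have := subdifferential_monotone (g_proper i)
  (iterate_subdifferential k i) (minimizer_subdifferential i).
move: (G (x k)) (G xstar) (x k.+1) => u v y; rewrite !mxE => h.
set r := (X in 0 <= X); suff -> : r = L^-1 *
    ((L * (x k 0 i - y 0 i) - u 0 i - - v 0 i) * (y 0 i - xstar 0 i)).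
  by rewrite pmulr_rge0// invr_gt0.
by rewrite /r; field; rewrite gt_eqF.
Qed.

(** Iterate the contraction, using 1 - mu / L <= exp (- mu / L). *)
Lemma iterate_expR k :
  enorm (x k - xstar) <= expR (- (k%:R * (mu / L))) * enorm (x 0%N - xstar).
Proof.
rewrite -mulrN expRM_natl; elim: k => [|k IH]; first by rewrite expr0 mul1r.
rewrite (le_trans (iterate_contraction k))// exprS -mulrA.
apply: ler_pM => //; rewrite ?enorm_ge0 ?expR_ge1Dx//.
by rewrite subr_ge0 ler_pdivrMr ?mul1r.
Qed.

(** Monotonicity places the subgradient [w] below the whole subdifferential at [xstar]. One [L]
    comes from the change of gradient, the other from the coordinate of [x k - xstar]. The strict
    inequality is what lets the threshold [delta] itself be attained later. *)
Lemma lower_gap_lt k i : x k.+1 0 i < xstar 0 i ->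
  ((- G xstar 0 i)%R%:E - subdiff_lower (g i) (xstar 0%R i)
     < (2 * L * enorm (x k - xstar))%R%:E)%E.
Proof.
move=> x_lt; set w := L * (x k 0 i - x k.+1 0 i) - G (x k) 0 i.
have w_le : (w%:E <= subdiff_lower (g i) (xstar 0%R i))%E.
  apply: le_ereal_inf_tmp => _ /= [v /interior_subset hv <-]; rewrite lee_fin.
  have := subdifferential_monotone (g_proper i)
    (iterate_subdifferential k i) hv.
  by rewrite nmulr_lge0 ?subr_lt0// subr_le0.
apply: (@le_lt_trans _ _ ((- G xstar 0 i)%R%:E - w%:E)%E).
  by rewrite leeD2l// leeN2.
rewrite -EFinB lte_fin /w.
have := ler_coord_enorm (x k - xstar) i.
have := le_trans (ler_coord_enorm (G (x k) - G xstar) i) (f_lip xstar (x k)).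
move: (G (x k)) (G xstar) => u v; rewrite !mxE !ler_norml.
move=> /andP[_ uv] /andP[x_ge _].
have : L * (x k 0 i - xstar 0 i) >= L * - enorm (x k - xstar).
  by rewrite ler_pM2l.
have : L * x k.+1 0 i < L * xstar 0 i by rewrite ltr_pM2l.
lra.
Qed.

Lemma upper_gap_lt k i : xstar 0 i < x k.+1 0 i ->
  (subdiff_upper (g i) (xstar 0%R i) + (G xstar 0 i)%R%:E
     < (2 * L * enorm (x k - xstar))%R%:E)%E.
Proof.
move=> x_gt; set w := L * (x k 0 i - x k.+1 0 i) - G (x k) 0 i.
have w_ge : (subdiff_upper (g i) (xstar 0%R i) <= w%:E)%E.
  apply: ge_ereal_sup => _ /= [v /interior_subset hv <-]; rewrite lee_fin.
  have := subdifferential_monotone (g_proper i)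
    (iterate_subdifferential k i) hv.
  by rewrite pmulr_lge0 ?subr_gt0// subr_ge0.
apply: (@le_lt_trans _ _ (w%:E + (G xstar 0 i)%R%:E)%E).
  by rewrite leeD2r.
rewrite -EFinD lte_fin /w.
have := ler_coord_enorm (x k - xstar) i.
have := le_trans (ler_coord_enorm (G (x k) - G xstar) i) (f_lip xstar (x k)).
move: (G (x k)) (G xstar) => u v; rewrite !mxE !ler_norml.
move=> /andP[uv _] /andP[_ x_le].
have : L * (x k 0 i - xstar 0 i) <= L * enorm (x k - xstar).
  by rewrite ler_pM2l.
have : L * xstar 0 i < L * x k.+1 0 i by rewrite ltr_pM2l.
lra.
Qed.

Lemma active_coordinate_fixed k i : i \in active_set g xstar ->
  ((2 * L * enorm (x k - xstar))%R%:E <= boundary_dist f g xstar)%E ->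
  x k.+1 0 i = xstar 0 i.
Proof.
move=> iZ /le_trans/(_ (bigmin_le_cond _ _ iZ)).
rewrite le_min => /andP[lo up]; apply/eqP; case: ltgtP => // x_neq.
  by have := lt_le_trans (lower_gap_lt x_neq) lo; rewrite ltxx.
by have := lt_le_trans (upper_gap_lt x_neq) up; rewrite ltxx.
Qed.

End Identification.

(** * The logarithmic iteration bound in extended reals *)

Lemma boundary_dist_ge0 {R : realType} {n : nat} (f : 'rV[R]_n -> R)
    (g : 'I_n -> R -> \bar R) (x : 'rV[R]_n) :
  nondegenerate f g x -> (0 <= boundary_dist f g x)%E.
Proof.
move=> x_nondeg; apply/bigmin_geP; split => [|i]; first exact: le0y.
rewrite inE => /asboolP /(proj2 (x_nondeg i)) Gi; rewrite le_min; apply/andP.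
split.
  rewrite sube_ge0 ?orbT//.
  by apply: ereal_inf_lbound; exists (- gradient f x 0 i).
rewrite -[(gradient f x 0 i)%:E]oppeK sube_ge0 ?orbT//.
by apply: ereal_sup_ubound; exists (- gradient f x 0 i).
Qed.

(** Undoes the logarithm, including the degenerate cases: for [d = +oo] the right side is infinite,
    for [r = 0] it is nonnegative, and for [d = 0 < r] the logarithm is [+oo], against the finite
    bound. *)
Lemma le_mul_expR_lne {R : realType} (k r : R) (d : \bar R) :
  0 <= r -> (0 <= d)%E -> (lne (r%:E / d) <= k%:E)%E ->
  (r%:E <= d * (expR k)%:E)%E.
Proof.
move=> r_ge0; case: d => [d||] //=; last first.
  by rewrite gt0_mulye ?leey// lte_fin expR_gt0.
rewrite lee_fin => d_ge0.
have [->|r_neq0] := eqVneq r 0.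
  by rewrite -EFinM lee_fin mulr_ge0 ?expR_ge0.
have r_gt0 : 0 < r by rewrite lt_neqAle eq_sym r_neq0.
have [->|d_neq0] := eqVneq d 0.
  by rewrite inve0 gt0_muley ?lte_fin.
have d_gt0 : 0 < d by rewrite lt_neqAle eq_sym d_neq0.
rewrite inver (negPf d_neq0) -EFinM lne_EFin ?divr_gt0// !lee_fin.
by rewrite -ler_expR lnK ?posrE ?divr_gt0// ler_pdivrMr// mulrC.
Qed.

Theorem corollary1 (R : realType) (n : nat) (mu L : R)
    (f : 'rV[R]_n -> R) (g : 'I_n -> R -> \bar R)
    (xstar : 'rV[R]_n) (x : nat -> 'rV[R]_n) :
  0 < mu ->
  (forall y, differentiable f y) ->
  strongly_convex mu f ->
  lipschitz_gradient L f ->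
  (forall i, proper_fun (g i)) ->
  (forall i, econvex (g i)) ->
  (forall i, lower_semicontinuous (g i)) ->
  argmin (fun y => ((f y)%:E + separable_sum g y)%E) xstar ->
  nondegenerate f g xstar ->
  proximal_gradient (1 / L) f (separable_sum g) x ->
  let kappa := L / mu in
  let delta := boundary_dist f g xstar in
  forall kbar : nat,
    (kappa%:E * lne ((2 * L * enorm (x 0%N - xstar))%R%:E / delta)
       <= kbar%:R%:E)%E ->
    forall (k : nat) (i : 'I_n),
      (kbar < k)%N -> i \in active_set g xstar -> x k 0 i = xstar 0 i.
Proof.
move=> mu_gt0 _ f_sc f_lip g_proper g_convex _ xstar_min x_nondeg x_pg.
(* The iterate index is now [k.+1] with [kbar <= k], so the distance to control is that of [x k]. *)
move=> kappa delta kbar kbar_ge [//|k] i kbar_lek iZ.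
(* The active coordinate [i] witnesses that the dimension is positive. *)
have mu_le_L := convexity_le_lipschitz f_sc f_lip i.
have L_gt0 : 0 < L := lt_le_trans mu_gt0 mu_le_L.
apply: (active_coordinate_fixed mu_gt0 mu_le_L f_lip g_proper g_convex x_pg iZ).
set r := 2 * L * enorm (x 0%N - xstar).
have r_ge0 : 0 <= r by rewrite mulr_ge0 ?enorm_ge0 ?mulr_ge0 ?ltW.
have rate_ge0 : 0 <= mu / L by rewrite divr_ge0 ?ltW.
have r_le : (r%:E <= delta * (expR (kbar%:R * (mu / L)))%:E)%E.
  apply: le_mul_expR_lne => //; first exact: boundary_dist_ge0.
  move: kbar_ge; rewrite -/r muleC -lee_pdivlMr ?divr_gt0//.
  by rewrite -EFinM /kappa invf_div.
(* The decay over [k] steps is weakened to [kbar] steps, where [r_le] applies. *)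
apply: (@le_trans _ _ (r * expR (- (kbar%:R * (mu / L))))%:E).
  rewrite lee_fin /r -[leRHS]mulrA ler_wpM2l ?mulr_ge0 ?(ltW L_gt0)//.
  rewrite [leRHS]mulrC.
  apply: le_trans (iterate_expR mu_gt0 mu_le_L f_sc f_lip g_proper g_convex
    xstar_min x_pg k) _.
  rewrite ler_wpM2r ?enorm_ge0// ler_expR lerN2 ler_wpM2r// ler_nat.
  by rewrite -ltnS.
by rewrite expRN EFinM lee_pdivrMr ?expR_gt0.
Qed.
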